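(* Let $d$ be a positive integer, let $g_1,\ldots,g_d:\mathbb{R}^d\times\mathbb{R}\to\mathbb{R}$ be continuous functions, let $\{\tau_j\}_{j\in\mathbb{Z}}$ be a Wexler sequence, and let $b_1,\ldots,b_d:\mathbb{Z}\to\mathbb{R}$ be sequences such that for each $i=1,\ldots,d$: $b_i\in AP(\mathbb{Z},\mathbb{R})$, $\inf_{n\in\mathbb{Z}}|1+b_i(n)|>0$, and the difference equation $$x(n)=[1+b_i(n)]\,x(n-1),\quad n\in\mathbb{Z},$$ admits a bounded solution $v_i:\mathbb{Z}\to\mathbb{R}$ with $\inf_{n\in\mathbb{Z}}|v_i(n)|>0$. For $i=1,\ldots,d$ define $$u_i(n)=\begin{cases}\prod_{k=1}^n[1+b_i(k)], & n>0,\\ 1, & n=0,\\ \prod_{k=n+1}^0\frac{1}{1+b_i(k)}, & n<0,\end{cases}\qquad \psi_i(t)=u_i(n)\ \text{ for }\ \tau_n<t\le\tau_{n+1},\ n\in\mathbb{Z}.$$ Consider the impulsive system $$(\mathrm{I})\quad\begin{cases} y_i'=g_i(y_1,\ldots,y_d,t), & t\neq\tau_n,\\ y_i(\tau_n^+)=[1+b_i(n)]\,y_i(\tau_n), & n\in\mathbb{Z},\ i=1,\ldots,d,\end{cases}$$ and the system $$(\mathrm{D})\quad y_i'=\frac{g_i(\psi_1(t)y_1,\ldots,\psi_d(t)y_d,t)}{\psi_i(t)},\quad t\neq\tau_n,\ n\in\mathbb{Z},\ i=1,\ldots,d.$$ Then: (i) If $(\phi_1,\ldots,\phi_d)$ is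 a p.c.a.p. solution to (I) and $\phi_i(\tau_n)\neq 0$ for all $n\in\mathbb{Z}$ and $i=1,\ldots,d$, then $(\phi_1/\psi_1,\ldots,\phi_d/\psi_d)$ is a Bohr almost periodic solution to (D). (ii) If $(\phi_1/\psi_1,\ldots,\phi_d/\psi_d)$ is a Bohr almost periodic solution to (D), then $(\phi_1,\ldots,\phi_d)$ is a p.c.a.p. solution to (I).
   Context: Let $\mathbb{G}=\mathbb{R}$ or $\mathbb{Z}$. A subset $S\subset\mathbb{G}$ is relatively dense if there is a positive $l\in\mathbb{G}$ such that $[a,a+l]\cap S\neq\emptyset$ for all $a\in\mathbb{G}$. A continuous function $f:\mathbb{G}\to\mathbb{R}$ is Bohr almost periodic if for every $\epsilon>0$ the set $T(f,\epsilon)=\{\tau\in\mathbb{G}: |f(t+\tau)-f(t)|<\epsilon\ \forall t\in\mathbb{G}\}$ is relatively dense; $AP(\mathbb{G},\mathbb{R})$ is the set of all such functions (every function on $\mathbb{Z}$ is regarded as continuous). A sequence $\{\tau_j\}_{j\in\mathbb{Z}}\subset\mathbb{R}$ is admissible if $\tau_j<\tau_{j+1}$ for all $j$ and $\lim_{j\to\pm\infty}\tau_j=\pm\infty$. Put $\tau_j^k=\tau_{j+k}-\tau_j$ for $j,k\in\mathbb{Z}$. The family $\{\{\tau_j^k\}_{j\in\mathbb{Z}}\}_{k\in\mathbb{Z}}$ is equi-potentially almost periodic if for each $\epsilon>0$ the set $\{p\in\mathbb{Z}: |\tau_{j+p}^k-\tau_j^k|<\epsilon \text{ for all } j,k\in\mathbb{Z}\}$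 is relatively dense in $\mathbb{Z}$. A Wexler sequence is an admissible sequence with $\inf_{j\in\mathbb{Z}}\tau_j^1>0$ for which this family is equi-potentially almost periodic. $PC(\mathbb{R},\mathbb{R})$ is the set of functions $h:\mathbb{R}\to\mathbb{R}$ which have discontinuities, all of the first kind (finite one-sided limits exist), only at the points of a subset (possibly empty) of some admissible sequence $\{\tau_j\}$, and are continuous from the left at each $\tau_j$. The right limit at $\tau_n$ is denoted $h(\tau_n^+)$. A function $h\in PC(\mathbb{R},\mathbb{R})$ is piecewise continuous almost periodic (p.c.a.p.) if: (i) there is an admissible sequence $\{\tau_j\}_{j\in\mathbb{Z}}$ containing the possible discontinuities of $h$ such that the family $\{\{\tau_j^k\}_{j}\}_{k}$ is equi-potentially almost periodic; (ii) for each $\epsilon>0$ there is $\delta>0$ such that $|h(s)-h(t)|<\epsilon$ whenever $s,t\in(\tau_j,\tau_{j+1}]$ for some $j\in\mathbb{Z}$ and $|s-t|<\delta$; (iii) for each $\epsilon>0$ the set $T(h,\epsilon)=\{\tau\in\mathbb{R}: |h(t+\tau)-h(t)|<\epsilon$ for all $t\in\mathbb{R}$ such that $|t-\tau_j|>\epsilon$ for all $j\in\mathbb{Z}\}$ is relatively dense in $\mathbb{R}$. When $h$ is said to have discontinuities at the points of a subset of a given sequence $\{\tau_j\}$, that sequence is the one used in (i)-(iii). Solutions are real-valued functions on all of $\mathbb{R}$. A solution of (I) is a tuple of functions in $PC(\mathbb{R},\mathbb{R})$, with discontinuities only at points of $\{\tau_n\}$ and left continuous there, differentiable at every $t\notin\{\tau_n\}$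 and satisfying the differential equations there, together with the jump conditions at every $\tau_n$. A solution of (D) is a tuple of continuous functions on $\mathbb{R}$, differentiable at every $t\notin\{\tau_n\}$ and satisfying (D) there. A p.c.a.p. (respectively Bohr almost periodic) solution is one all of whose components are p.c.a.p. with respect to the given sequence $\{\tau_n\}$ (respectively in $AP(\mathbb{R},\mathbb{R})$). *)

(* Defs.v *)
From HB Require Import structures.
From mathcomp Require Import all_boot all_order all_algebra.
From mathcomp Require Import all_classical all_reals all_analysis.

Set Implicit Arguments.
Unset Strict Implicit.
Unset Printing Implicit Defensive.

Import Order.TTheory GRing.Theory Num.Theory.
Import numFieldNormedType.Exports.

Local Open Scope classical_set_scope.
Local Open Scope ring_scope.

(* G is meant to be the real line or int. *)
Definition relatively_dense (G : numDomainType) (S : set G) : Prop :=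
  exists2 l : G, 0 < l & forall a : G, exists2 x : G, a <= x <= a + l & S x.

Definition almost_periods (R : realType) (G : numDomainType) (f : G -> R)
    (eps : R) : set G :=
  [set s : G | forall t : G, `|f (t + s) - f t| < eps].

Definition AP_real (R : realType) (f : R -> R) : Prop :=
  continuous f /\
  forall eps : R, 0 < eps -> relatively_dense (almost_periods f eps).

(* No continuity clause: Z carries the discrete topology. *)
Definition AP_int (R : realType) (f : int -> R) : Prop :=
  forall eps : R, 0 < eps -> relatively_dense (almost_periods f eps).

Definition admissible (R : realType) (tau : int -> R) : Prop :=
  [/\ forall j : int, tau j < tau (j + 1),
      tau n%:Z @[n --> \oo] --> +oo
    & tau (- n%:Z) @[n --> \oo] --> -oo].

(* tau_j^k *)
Definition gap (R : realType) (tau : int -> R) (k j : int) : R :=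
  tau (j + k) - tau j.

Definition equipotentially_AP (R : realType) (tau : int -> R) : Prop :=
  forall eps : R, 0 < eps ->
    relatively_dense
      [set p : int | forall j k : int,
         `|gap tau k (j + p) - gap tau k j| < eps].

Definition Wexler (R : realType) (tau : int -> R) : Prop :=
  [/\ admissible tau,
      0 < inf (range (gap tau 1))
    & equipotentially_AP tau].

(* The members of PC(R,R) whose discontinuities lie on the given tau. *)
Definition PC_on (R : realType) (tau : int -> R) (h : R -> R) : Prop :=
  [/\ forall t : R, ~ range tau t -> {for t, continuous h},
      forall j : int, h t @[t --> (tau j)^'-] --> h (tau j)
    & forall j : int, cvg (h t @[t --> (tau j)^'+])].

Definition pcap (R : realType) (tau : int -> R) (h : R -> R) : Prop :=
  [/\ admissible tau /\ PC_on tau h,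
      equipotentially_AP tau,
      forall eps : R, 0 < eps -> exists2 delta : R, 0 < delta &
        forall (j : int) (s t : R),
          tau j < s <= tau (j + 1) -> tau j < t <= tau (j + 1) ->
          `|s - t| < delta -> `|h s - h t| < eps
    & forall eps : R, 0 < eps ->
        relatively_dense
          [set s : R | forall t : R, (forall j : int, eps < `|t - tau j|) ->
             `|h (t + s) - h t| < eps]].

(* For n = Negz m = - (m + 1) the product over n + 1 <= k <= 0 is reindexed
   by k = - j with 0 <= j <= m. *)
Definition mult_prod (R : realType) (b : int -> R) (n : int) : R :=
  match n with
  | Posz m => \prod_(1 <= k < m.+1) (1 + b k%:Z)
  | Negz m => \prod_(0 <= j < m.+1) (1 + b (- j%:Z))^-1
  end.

(* When tau is admissible there is exactly one n with tau n < t <= tau (n + 1);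
   otherwise the default index 0 may be used. *)
Definition step_fun (R : realType) (tau : int -> R) (b : int -> R) (t : R) : R :=
  mult_prod b (xget 0 [set n : int | tau n < t <= tau (n + 1)]).

Definition solution_I (R : realType) (d : nat)
    (g : 'I_d -> 'rV[R]_d * R -> R) (tau : int -> R) (b : 'I_d -> int -> R)
    (y : 'I_d -> R -> R) : Prop :=
  [/\ forall i, PC_on tau (y i),
      forall i (t : R), ~ range tau t ->
        is_derive t 1 (y i) (g i (\row_j y j t, t))
    & forall i (n : int),
        y i t @[t --> (tau n)^'+] --> (1 + b i n) * y i (tau n)].

Definition solution_D (R : realType) (d : nat)
    (g : 'I_d -> 'rV[R]_d * R -> R) (tau : int -> R) (b : 'I_d -> int -> R)
    (y : 'I_d -> R -> R) : Prop :=
  (forall i, continuous (y i)) /\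
  forall i (t : R), ~ range tau t ->
    is_derive t 1 (y i)
      (g i (\row_j (step_fun tau (b j) t * y j t), t) / step_fun tau (b i) t).

(* Main.v *)
Require Import Defs.
From HB Require Import structures.
From mathcomp Require Import all_boot all_order all_algebra.
From mathcomp Require Import all_classical all_reals all_analysis.
From mathcomp Require Import zify ring lra.

(** Write [u_i] for [mult_prod (b i)], so that [psi_i t = u_i n] when
    [tau n < t <= tau (n + 1)].

    Since [v_i n = u_i n * v_i 0], the hypotheses on [v_i] bound [|u_i|] from
    above and away from [0].  Moreover [u_i] is almost periodic on the integers
    ([AP_int_linear_recurrence]): the function [ln |u_i|] is bounded and its
    increments [ln |1 + b_i n|] are almost periodic, so Bohr's theorem on bounded
    primitives ([bounded_primitive_almost_periods]) applies to it; and if [p] is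
    a fine enough almost period of [b_i], then the sign of [u_i (n + p) / u_i n]
    does not depend on [n], so that [2 p] is an almost period of [u_i] itself.

    Almost periods of a function of a real variable have to be matched with those
    of [tau] and of [u_i].  Given two relatively dense sets of reals, the
    pigeonhole principle yields a relatively dense set of differences of elements
    of the first which are close to differences of elements of the second
    ([relatively_dense_close_differences]).  Hence, for [S] relatively dense,
    there is a relatively dense set of [s = s1 - s2], with [s1] and [s2] in [S],
    for which some integer [p] is an almost period of [u_i] and satisfies
    [tau (m + p) - tau m ~ s] for all [m] ([relatively_dense_joint_periods]).  For
    such an [s], if [t] is not too close to [tau], then [t] and [t + s] lie in the
    intervals of index [n] and [n + p], so that [psi_i (t + s)] is close to
    [psi_i t].

    If [f = phi / psi_i] is Bohr almost periodic, it is bounded and uniformly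
    continuous, and taking for [S] its almost periods shows that [f * psi_i] is
    piecewise continuous almost periodic.  In the converse direction [S] is made
    of almost periods of [phi], which control [phi (t + s) - phi t] only when both
    [t] and [t - s2] are away from [tau].  But the jump conditions make [f]
    continuous across the points of [tau], hence uniformly continuous on the whole
    line, and every point is within a small distance of one which is good in both
    respects ([away_exists]).

    The equivalence of the two systems of equations is immediate, as [psi_i] is
    constant near every point outside of [tau]. *)

Set Implicit Arguments.
Unset Strict Implicit.
Unset Printing Implicit Defensive.

Import Order.TTheory GRing.Theory Num.Theory.
Import numFieldNormedType.Exports.

Local Open Scope classical_set_scope.
Local Open Scope ring_scope.

(** * Relatively dense sets and almost periods *)

Lemma almost_periodsB (R : realType) (G : numDomainType) (f : G -> R)
    (e1 e2 : R) (s1 s2 : G) :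
  almost_periods f e1 s1 -> almost_periods f e2 s2 ->
  almost_periods f (e1 + e2) (s1 - s2).
Proof.
move=> h1 h2 t.
have := h1 (t - s2); have := h2 (t - s2).
rewrite subrK addrAC addrA !ltr_norml => /andP[? ?] /andP[? ?].
apply/andP; split; lra.
Qed.

Lemma almost_periods_le (R : realType) (G : numDomainType) (f : G -> R)
    (e1 e2 : R) : e1 <= e2 -> almost_periods f e1 `<=` almost_periods f e2.
Proof. by move=> e12 s fs t; exact: lt_le_trans (fs t) e12. Qed.

Lemma relatively_denseS (G : numDomainType) (S T : set G) :
  S `<=` T -> relatively_dense S -> relatively_dense T.
Proof.
move=> ST [l l0 h]; exists l => // a.
by have [x ax Sx] := h a; exists x => //; exact: ST.
Qed.

Lemma relatively_dense_intr (R : realType) (S : set int) :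
  relatively_dense S <-> relatively_dense ((fun n : int => n%:~R : R) @` S).
Proof.
split=> -[l l0 h].
- exists (l%:~R + 1); first by rewrite ltr_wpDl// ler0z ltW.
  move=> a; have /andP[a1 a2] := floor_itv a.
  have [x /andP[x1 x2] Sx] := h (Num.floor a + 1).
  exists x%:~R; last by exists x.
  move: x1 x2 a1 a2; rewrite -(ler_int R) -(ler_int R x) !rmorphD/= => *.
  by apply/andP; split; lra.
- exists (Num.floor l + 1); first by rewrite ltr_wpDl// floor_ge0 ltW.
  move=> a; have [y /andP[x1 x2] [x Sx xE]] := h a%:~R.
  have /andP[_ l2] := floor_itv l.
  exists x => //; rewrite -(ler_int R) -(ler_int R x) xE !rmorphD/=.
  rewrite rmorphD/= in l2.
  by apply/andP; split; lra.
Qed.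

Lemma finite_range_bounded_repr (N : nat) (f : int -> nat) :
  (forall a, (f a < N)%N) ->
  exists M : nat, forall a, exists2 a' : int, (`|a'| <= M%:Z) & f a = f a'.
Proof.
move=> fN; pose g (k : nat) : int := xget 0 [set a | f a = k].
exists (\sum_(k < N) `|g k|%N)%N => a; exists (g (f a)).
  have -> : g (f a) = g (Ordinal (fN a)) by [].
  by rewrite (bigD1 (Ordinal (fN a)))//=; lia.
by have /= -> := @xgetPex _ 0 [set c | f c = f a] (ex_intro _ a erefl).
Qed.

(** The sets [x @` A] and [y @` B] both meet all the intervals [[m L, m L + L]].
    By the pigeonhole principle, the differences [d m] between the points chosen
    there, rounded to multiples of [e], are already attained for bounded [m]. *)
Lemma relatively_dense_close_differences (R : realType) (X Y : Type)
    (x : X -> R) (y : Y -> R) (A : set X) (B : set Y) (e : R) :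
  0 < e -> relatively_dense (x @` A) -> relatively_dense (y @` B) ->
  relatively_dense [set s : R | exists a a' b b',
    [/\ A a, A a', B b & B b'] /\
    s = x a - x a' /\ `|s - (y b - y b')| < e].
Proof.
move=> e0 [l1 l10 h1] [l2 l20 h2]; pose L := l1 + l2.
have L0 : 0 < L by rewrite /L; lra.
have /choice[X0 X0P] : forall m : int,
    exists a, A a /\ m%:~R * L <= x a <= m%:~R * L + L.
  move=> m; have [z /andP[u1 u2] [a Aa ?]] := h1 (m%:~R * L).
  subst; exists a; split => //; apply/andP; split => //.
  by rewrite /L in u2 *; lra.
have /choice[Y0 Y0P] : forall m : int,
    exists a, B a /\ m%:~R * L <= y a <= m%:~R * L + L.
  move=> m; have [z /andP[u1 u2] [a Aa ?]] := h2 (m%:~R * L).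
  subst; exists a; split => //; apply/andP; split => //.
  by rewrite /L in u2 *; lra.
pose d m := x (X0 m) - y (Y0 m).
have dL m : 0 <= d m + L <= L + L.
  have [_ /andP[? ?]] := X0P m; have [_ /andP[? ?]] := Y0P m.
  by rewrite /d; apply/andP; split; lra.
(* the index of the cell of length [e] which contains [d m] *)
pose c m := `|Num.floor ((d m + L) / e)|%N.
have cE m : (c m)%:Z = Num.floor ((d m + L) / e).
  have /andP[? _] := dL m.
  by rewrite /c gez0_abs// floor_ge0 divr_ge0// ltW.
have cN m : (c m < `|Num.floor ((L + L) / e)|.+1)%N.
  have /andP[u1 u2] := dL m.
  have F0 : 0 <= Num.floor ((d m + L) / e) by rewrite -cE.
  have : Num.floor ((d m + L) / e) <= Num.floor ((L + L) / e).
    by apply: le_floor; rewrite ler_pM2r ?invr_gt0//.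
  by rewrite /c; lia.
have [M hM] := finite_range_bounded_repr cN.
(* With [|m'| <= M], [x (X0 m) - x (X0 m')] lies between [(m - M - 1) L] and
   [(m + M + 1) L]. *)
exists ((M%:R *+ 2 + 3%:R) * L).
  by rewrite mulr_gt0// ltr_wpDl// mulrn_wge0.
move=> t; pose m := Num.floor (t / L) + M%:Z + 2.
have [m' m'M cmm'] := hM m.
have [Am /andP[am1 am2]] := X0P m; have [Am' /andP[am'1 am'2]] := X0P m'.
have [Bm _] := Y0P m; have [Bm' _] := Y0P m'.
exists (x (X0 m) - x (X0 m')).
  have /andP[t1 t2] := floor_itv (t / L).
  rewrite ler_pdivlMr// in t1; rewrite ltr_pdivrMr// in t2.
  have m1 : - (M%:R * L) <= m'%:~R * L.
    rewrite -mulNr ler_pM2r// -[- _]/(- M%:Z%:~R : R) -rmorphN/= ler_int; lia.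
  have m2 : m'%:~R * L <= M%:R * L.
    rewrite ler_pM2r// -[M%:R]/(M%:Z%:~R : R) ler_int; lia.
  move: am1 am2 t1 t2; rewrite /m !rmorphD/= => am1 am2 t1 t2.
  by apply/andP; split; rewrite ?mulrDl in am1 am2 t2 *; lra.
exists (X0 m), (X0 m'), (Y0 m), (Y0 m'); split=> //; split=> //.
have -> : x (X0 m) - x (X0 m') - (y (Y0 m) - y (Y0 m')) = d m - d m'.
  by rewrite /d; ring.
have /andP[u1 u2] := floor_itv ((d m + L) / e).
have /andP[v1 v2] := floor_itv ((d m' + L) / e).
rewrite -!cE cmm' !rmorphD/= in u1 u2 v1 v2.
move: u1 u2 v1 v2; rewrite !ler_pdivlMr// !ltr_pdivrMr// => u1 u2 v1 v2.
by rewrite ltr_norml; apply/andP; split; lra.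
Qed.

(** Integers at distance less than [1] being equal, close differences of integers
    are common differences. *)
Lemma relatively_dense_common_differences (R : realType) (A B : set int) :
  relatively_dense A -> relatively_dense B ->
  relatively_dense [set p : int | exists a a' b b',
    [/\ A a, A a', B b & B b'] /\ p = a - a' /\ p = b - b'].
Proof.
move=> /(relatively_dense_intr R) hA /(relatively_dense_intr R) hB.
apply/(relatively_dense_intr R).
apply: relatively_denseS (relatively_dense_close_differences ltr01 hA hB).
move=> _ [a [a' [b [b' [[Aa Aa' Bb Bb'] [-> /= H]]]]]].
exists (a - a'); last by rewrite rmorphB.
exists a, a', b, b'; split=> //; split=> //.
have : `|a - a' - (b - b')| < 1 by rewrite -(ltr_int R) intr_norm !rmorphB.
by lia.
Qed.

(** * Bounded primitives and solutions of linear recurrences on the integers *)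

Lemma int_lipschitz (R : realType) (f : int -> R) (e : R) :
  (forall n, `|f n - f (n - 1)| <= e) ->
  forall n m, `|f n - f m| <= `|n - m|%:~R * e.
Proof.
move=> fe; have fk (k : nat) n : `|f (n + k%:Z) - f n| <= k%:R * e.
  elim: k => [|k IH]; first by rewrite addr0 subrr normr0 mul0r.
  have := fe (n + k.+1%:Z).
  have -> : n + k.+1%:Z - 1 = n + k%:Z by lia.
  move: IH; rewrite !ler_norml -[k.+1]addn1 natrD => /andP[? ?] /andP[? ?].
  by apply/andP; split; lra.
move=> n m; have [nm|mn] := leP n m.
  have -> : m = n + `|m - n|%N%:Z by lia.
  rewrite distrC (le_trans (fk _ _))//.
  by have -> : `|n - (n + `|m - n|%N%:Z)| = `|m - n|%N%:Z :> int by lia.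
have -> : n = m + `|n - m|%N%:Z by lia.
rewrite (le_trans (fk _ _))//.
by have -> : `|m + `|n - m|%N%:Z - m| = `|n - m|%N%:Z :> int by lia.
Qed.

(** Bohr's theorem on bounded primitives, in a discrete and uniform version.  The
    function [F] nearly reaches its infimum and its supremum, and hence does so in
    every interval of some fixed length.  If [p] is a fine almost period of the
    increments of [F], then [F (n + p) - F n] varies little over such an interval;
    it is nearly nonnegative where [F] is nearly minimal and nearly nonpositive
    where [F] is nearly maximal, hence small everywhere. *)
Lemma bounded_primitive_almost_periods (R : realType) (F : int -> R) (K : R) :
  (forall n, `|F n| <= K) -> AP_int (fun n => F n - F (n - 1)) ->
  forall e, 0 < e -> exists2 d, 0 < d &
    almost_periods (fun n => F n - F (n - 1)) d `<=` almost_periods F e.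
Proof.
move=> FK fAP e e0; pose f n := F n - F (n - 1).
rewrite -[fun n => _]/f in fAP *.
pose e1 := e / 5%:R; have e10 : 0 < e1 by rewrite /e1; lra.
have Fne : range F !=set0 by exists (F 0), 0.
have Finf : has_inf (range F).
  split=> //; exists (- K) => _ [n _ <-].
  by have := FK n; rewrite ler_norml => /andP[].
have Fsup : has_sup (range F).
  split=> //; exists K => _ [n _ <-].
  by have := FK n; rewrite ler_norml => /andP[].
have Fi n : inf (range F) <= F n by apply: ge_inf; [case: Finf|exists n].
have Fs n : F n <= sup (range F) by apply: sup_upper_bound => //; exists n.
have [_ [n1 _ <-] Fn1] := inf_adherent e10 Finf.
have [_ [n2 _ <-] Fn2] := sup_adherent e10 Fsup.
have drift p d : almost_periods f d p -> forall n m,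
    `|(F (n + p) - F n) - (F (m + p) - F m)| <= `|n - m|%:~R * d.
  move=> pd; apply: (@int_lipschitz R (fun n => F (n + p) - F n)) => n.
  have := ltW (pd n); rewrite /f (addrAC n (-1) p).
  by congr (`|_| <= _); ring.
pose N := `|n1 - n2|; have d1 : 0 < e1 / (N%:~R + 1).
  by rewrite divr_gt0// ltr_wpDl// ler0z normr_ge0.
have [l l0 hl] := fAP _ d1.
pose L := l + N; exists (e1 / (L%:~R + 1)).
  by rewrite divr_gt0// ltr_wpDl// ler0z /L; lia.
move=> p pd n.
have small (j M : int) :
    0 <= M -> `|j| <= M -> `|j|%:~R * (e1 / (M%:~R + 1)) <= e1.
  have M1 : 0 <= M -> 0 < M%:~R + 1 :> R by move=> ?; rewrite ltr_wpDl// ler0z.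
  move=> /M1{}M1 jM; rewrite mulrCA; apply: ler_piMr; first exact: ltW.
  by rewrite ler_pdivrMr// mul1r; rewrite -(ler_int R) in jM; lra.
(* The translation by [s] brings [n1] and [n2] into [[n, n + L]]; there [F] is
   still nearly extremal, at [n1 + s] and [n2 + s]. *)
have [s /andP[s1 s2] sT] := hl (n - Num.min n1 n2).
have D12 := le_trans (drift _ _ sT n1 n2) (small (n1 - n2) N _ _).
have D1 := le_trans (drift _ _ pd n (n1 + s)) (small (n - (n1 + s)) L _ _).
have D2 := le_trans (drift _ _ pd n (n2 + s)) (small (n - (n2 + s)) L _ _).
have {}D12 := D12 (normr_ge0 _) (lexx _).
have {}D1 : `|F (n + p) - F n - (F (n1 + s + p) - F (n1 + s))| <= e1.
  by apply: D1; rewrite /L /N; lia.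
have {}D2 : `|F (n + p) - F n - (F (n2 + s + p) - F (n2 + s))| <= e1.
  by apply: D2; rewrite /L /N; lia.
move: (Fi (n2 + s + p)) (Fs (n2 + s + p)).
move: (Fi (n1 + s + p)) (Fs (n1 + s + p)).
move: (Fs (n1 + s)) (Fs (n2 + s)) (Fi (n1 + s)) (Fi (n2 + s)).
move: D12 D1 D2.
rewrite !ler_norml ltr_norml => /andP[? ?] /andP[? ?] /andP[? ?].
have eE : e = 5%:R * e1 by rewrite /e1; lra.
rewrite eE; move=> *.
by apply/andP; split; lra.
Qed.

Lemma ln_dist_le (R : realType) (c x y : R) : 0 < c -> c <= x -> c <= y ->
  `|ln x - ln y| <= `|x - y| / c.
Proof.
move=> c0.
wlog yx : x y / y <= x.
  move=> H cx cy; have [/H->//|/ltW/H] := leP y x.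
  by rewrite distrC (distrC y x); exact.
move=> cx cy; have y0 : 0 < y by lra.
have x0 : 0 < x by lra.
rewrite !ger0_norm ?subr_ge0 ?ler_ln ?posrE//.
rewrite -ln_div ?posrE//.
have -> : x / y = 1 + (x - y) / y by field; lra.
apply: (le_trans (le_ln1Dx _)).
  by rewrite (@lt_le_trans _ _ 0)// divr_ge0 ?subr_ge0// ltW.
rewrite ler_wpM2l ?subr_ge0// lef_pV2 ?posrE//.
Qed.

Lemma dist_le_ln (R : realType) (K x y : R) : 0 < x <= K -> 0 < y <= K ->
  `|x - y| <= K * `|ln x - ln y|.
Proof.
wlog yx : x y / y <= x.
  move=> H cx cy; have [/H->//|/ltW/H] := leP y x.
  by rewrite distrC (distrC (ln y)); exact.
move=> /andP[x0 xK] /andP[y0 yK].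
rewrite !ger0_norm ?subr_ge0 ?ler_ln ?posrE//.
rewrite (@le_trans _ _ (x * (ln x - ln y)))//; last first.
  by rewrite ler_wpM2r// subr_ge0 ler_ln ?posrE.
have : ln (1 + (y - x) / x) <= (y - x) / x.
  by apply: le_ln1Dx; rewrite ltr_pdivlMr//; lra.
have -> : 1 + (y - x) / x = y / x by field; lra.
rewrite ln_div ?posrE// ler_pdivlMr//; lra.
Qed.

(** Bohr's theorem applied to [ln |v|] gives almost periods of [|v|]; the sign of
    [v (n + p) * v n] is independent of [n] if [p] is a fine almost period of [b],
    and hence [v (n + 2 p) * v n] is positive. *)
Lemma AP_int_linear_recurrence (R : realType) (b v : int -> R) (c k K : R) :
  AP_int b -> 0 < c -> (forall n, c <= `|1 + b n|) ->
  0 < k -> (forall n, k <= `|v n| <= K) ->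
  (forall n, v n = (1 + b n) * v (n - 1)) -> AP_int v.
Proof.
move=> bAP c0 bc k0 vkK vrec.
have v0 n : 0 < `|v n| by have /andP[? _] := vkK n; lra.
have K0 : 0 < K by have /andP[? ?] := vkK 0; lra.
pose F n := ln `|v n|.
have FE n : F n - F (n - 1) = ln `|1 + b n|.
  have := bc n => bcn; rewrite /F {1}vrec normrM lnM ?posrE ?v0//; [ring|lra].
have bF d : almost_periods b (d * c) `<=`
    almost_periods (fun n => F n - F (n - 1)) d.
  move=> p pb n; rewrite !FE.
  apply: le_lt_trans (ln_dist_le c0 (bc _) (bc _)) _.
  rewrite ltr_pdivrMr//; apply: le_lt_trans (pb n).
  have -> : b (n + p) - b n = (1 + b (n + p)) - (1 + b n) by ring.
  exact: ler_dist_dist.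
have FAP : AP_int (fun n => F n - F (n - 1)).
  by move=> d d0; apply: relatively_denseS (bF d) (bAP _ _); rewrite mulr_gt0.
have Fbd n : `|F n| <= Num.max `|ln k| `|ln K|.
  have /andP[kv vK] := vkK n; have v0n := v0 n.
  have : ln k <= F n by rewrite ler_ln ?posrE.
  have : F n <= ln K by rewrite ler_ln ?posrE.
  rewrite le_max; have [F0|F0] := lerP 0 (F n) => FK kF.
    by apply/orP; right; rewrite ger0_norm// (le_trans FK)// ler_norm.
  by apply/orP; left; rewrite ltr0_norm// ler_normr lerN2 kF orbT.
move=> e e0.
have e'0 : 0 < e / (K * 2%:R) by rewrite divr_gt0// mulr_gt0.
have [d d0 dF] := bounded_primitive_almost_periods Fbd FAP e'0.
have dc0 : 0 < Num.min (d * c) c by rewrite lt_min mulr_gt0.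
have [l l0 hl] := bAP _ dc0.
(* An element [p] of [[m, m + l]], for [m = (a + 1) %/ 2], satisfies
   [a <= 2 p <= a + 2 l + 1]. *)
exists (l *+ 2 + 1); first by lia.
move=> a; have [p /andP[p1 p2] pb] := hl ((a + 1) %/ 2)%Z.
exists (p *+ 2); first by lia.
have pF : almost_periods F (e / (K * 2%:R)) p.
  by apply: dF; apply: bF; apply: almost_periods_le pb; rewrite ge_min lexx.
have sgb n : 0 < (1 + b (n + p)) * (1 + b n).
  have := pb n; rewrite lt_min => /andP[_]; have := bc n; have := bc (n + p).
  rewrite !ler_normr ltr_norml => /orP[?|?] /orP[?|?] /andP[? ?]; try lra.
    by apply: mulr_gt0; lra.
  by rewrite -mulrNN; apply: mulr_gt0; lra.
have sgv n : (0 < v (n + p) * v n) = (0 < v (n - 1 + p) * v (n - 1)).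
  rewrite (vrec n) (vrec (n + p)) mulrACA pmulr_rgt0//.
  by rewrite (addrAC n).
have sgv0 n : (0 < v (n + p) * v n) = (0 < v (0 + p) * v 0).
  elim: n => [//|m|m] IH.
    by rewrite sgv -IH; congr (0 < v (_ + _) * v _); lia.
  by rewrite -IH (sgv (- m%:Z)); congr (0 < v (_ + _) * v _); lia.
have vn0 n : v n != 0 by rewrite -normr_gt0.
have sg2 n : 0 < v (n + p *+ 2) * v n.
  have : 0 < (v (n + p + p) * v (n + p)) * (v (n + p) * v n).
    have := sgv0 (n + p); rewrite -(sgv0 n) => E.
    have [/[dup]|N] := boolP (0 < v (n + p) * v n).
      by rewrite -{1}E; exact: mulr_gt0.
    rewrite nmulr_rgt0 lt_neqAle mulf_neq0 ?vn0//= leNgt// E//.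
  have -> : n + p *+ 2 = n + p + p by lia.
  have -> : v (n + p + p) * v (n + p) * (v (n + p) * v n) =
      v (n + p) ^+ 2 * (v (n + p + p) * v n) by ring.
  by rewrite pmulr_rgt0// exprn_even_gt0//= vn0.
move=> n.
have -> : `|v (n + p *+ 2) - v n| = `| `|v (n + p *+ 2)| - `|v n| |.
  have /orP[vn|vn] : (v n < 0) || (0 < v n) by rewrite -neq_lt.
    have := sg2 n; rewrite nmulr_lgt0// => vnp.
    by rewrite (ltr0_norm vn) (ltr0_norm vnp) -opprD normrN.
  have := sg2 n; rewrite pmulr_lgt0// => vnp.
  by rewrite (gtr0_norm vn) (gtr0_norm vnp).
apply: (le_lt_trans (dist_le_ln (K := K) _ _)).
- by rewrite v0; have /andP[] := vkK (n + p *+ 2).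
- by rewrite v0; have /andP[] := vkK n.
rewrite -ltr_pdivlMl// mulrC.
have := pF (n + p); have := pF n.
rewrite -/(F n) -/(F (n + p *+ 2)) !ltr_norml.
have -> : n + p *+ 2 = n + p + p by lia.
have -> : e / (K * 2%:R) = (e / K) / 2%:R by field; lra.
move=> /andP[? ?] /andP[? ?]; apply/andP; split; lra.
Qed.

(** * Bohr almost periodic functions on the real line *)

Lemma continuous_itv_bounded (R : realType) (f : R -> R) (a b : R) :
  a <= b -> continuous f -> exists M : R, forall t, a <= t <= b -> `|f t| <= M.
Proof.
move=> ab fc.
have nfc : continuous (fun t => `|f t|).
  by move=> t; apply: cvg_norm; exact: fc.
have [c _ cM] := EVT_max ab (continuous_subspaceT nfc).
by exists `|f c| => t tab; apply: cM; rewrite in_itv.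
Qed.

(** The point [t] is not required to belong to the segment. *)
Lemma continuous_itv_uniform (R : realType) (f : R -> R) (a b e : R) :
  continuous f -> 0 < e -> exists2 d : R, 0 < d &
    forall s t, a <= s <= b -> `|s - t| < d -> `|f s - f t| < e.
Proof.
move=> fc e0.
have /compact_near_coveringP cpt := @segment_compact R a b.
have := cpt _ (0 : R)^'+
  (fun d s => forall t, `|s - t| < d -> `|f s - f t| < e) _.
move=> H; have {H}: \forall d \near (0 : R)^'+,
    `[a, b]%classic `<=` (fun s => forall t, `|s - t| < d -> `|f s - f t| < e).
  apply: H => x xab.
  have := fc x => /cvgrPdist_lt /(_ (e / 2%:R)).
  rewrite divr_gt0// => /(_ isT) /nbhs_ballP[r /= r0 hr].
  have r20 : 0 < r / 2%:R by rewrite divr_gt0.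
  exists (ball x (r / 2%:R), [set d | d < r / 2%:R]).
    by split; [exact: nbhsx_ballx|exact: nbhs_right_lt].
  move=> [x' d] /= [x'x dr] t x't.
  have h1 : `|x - x'| < r by rewrite (lt_le_trans x'x)//; lra.
  have h2 : `|x - t| < r.
    move: x'x x't; rewrite /ball/= !ltr_norml => /andP[? ?] /andP[? ?].
    by apply/andP; split; lra.
  have := hr _ h1; have := hr _ h2.
  by rewrite !ltr_norml => /andP[? ?] /andP[? ?]; apply/andP; split; lra.
move=> H.
near (0 : R)^'+ => d.
exists d => // s t sab std.
have dP : `[a, b]%classic `<=`
    (fun s => forall t, `|s - t| < d -> `|f s - f t| < e) by near: d.
by apply: dP => //=; rewrite in_itv.
Unshelve. all: by end_near. Qed.

Lemma AP_real_bounded (R : realType) (f : R -> R) :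
  AP_real f -> exists M : R, forall t, `|f t| <= M.
Proof.
move=> [fc fAP]; have [l l0 hl] := fAP 1 ltr01.
have [M hM] := continuous_itv_bounded (ltW l0) fc.
exists (M + 1) => t; have [s /andP[s1 s2] sf] := hl (- t).
have /hM : 0 <= t + s <= l by apply/andP; split; lra.
have := sf t; rewrite ltr_norml !ler_norml => /andP[? ?] /andP[? ?].
by apply/andP; split; lra.
Qed.

(** Uniform continuity on the whole real line, in terms of distances. *)
Definition uniformly_continuous (R : realType) (f : R -> R) : Prop :=
  forall e : R, 0 < e -> exists2 d : R, 0 < d &
    forall s t, `|s - t| < d -> `|f s - f t| < e.

Lemma AP_real_uniformly_continuous (R : realType) (f : R -> R) :
  AP_real f -> uniformly_continuous f.
Proof.
move=> [fc fAP] e e0; have e30 : 0 < e / 3%:R by rewrite divr_gt0.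
have [l l0 hl] := fAP _ e30.
have [d d0 hd] := continuous_itv_uniform 0 l fc e30.
exists d => // s t std; have [r /andP[r1 r2] rf] := hl (- s).
have srl : 0 <= s + r <= l by apply/andP; split; lra.
have srt : `|s + r - (t + r)| < d by rewrite opprD addrACA subrr addr0.
have := hd _ _ srl srt; have := rf s; have := rf t.
rewrite !ltr_norml => /andP[? ?] /andP[? ?] /andP[? ?].
by apply/andP; split; lra.
Qed.

(** The infimum of a set of reals without lower bound is [0] by convention, so
    that a positive infimum is a lower bound. *)
Lemma inf_gt0_lower_bound (R : realType) (X : Type) (f : X -> R) (x0 : X) :
  0 < inf (range f) -> forall x, inf (range f) <= f x.
Proof.
move=> f0 x; apply: ge_inf; last by exists x.
apply: contrapT => nlb; move: f0; rewrite inf_out ?ltxx//.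
by move=> [].
Qed.

(** * Wexler sequences *)

Section WexlerSequence.
Variables (R : realType) (tau : int -> R).
Hypothesis tauW : Wexler tau.

(** The infimum of the lengths of the intervals between consecutive points. *)
Definition min_gap : R := inf (range (gap tau 1)).

Lemma min_gap_gt0 : 0 < min_gap. Proof. by case: tauW. Qed.

Lemma min_gap_le n : min_gap <= tau (n + 1) - tau n.
Proof. by case: tauW => _ /(inf_gt0_lower_bound 0) /(_ n). Qed.

Lemma min_gap_leD n (k : nat) : tau n + k%:R * min_gap <= tau (n + k%:Z).
Proof.
elim: k => [|k IH]; first by rewrite mul0r !addr0.
have := min_gap_le (n + k%:Z).
have -> : n + k%:Z + 1 = n + k.+1%:Z by lia.
rewrite -[k.+1%:R]natr1; lra.
Qed.

Lemma tau_min_gap (m n : int) : m < n -> tau m + min_gap <= tau n.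
Proof.
move=> mn; have -> : n = m + 1 + `|(n - (m + 1))%R|%N%:Z by lia.
have := min_gap_leD (m + 1) `|(n - (m + 1))%R|%N.
have := min_gap_le m; have := min_gap_gt0 => g0.
have : 0 <= `|(n - (m + 1))%R|%N%:R * min_gap by rewrite mulr_ge0// ltW.
lra.
Qed.

Lemma tau_le (m n : int) : m <= n -> tau m <= tau n.
Proof.
rewrite le_eqVlt => /predU1P[->//|/tau_min_gap].
by have := min_gap_gt0; lra.
Qed.

Lemma index_exists t : exists n, tau n < t <= tau (n + 1).
Proof.
have g0 := min_gap_gt0.
pose N := `|Num.floor (`|t - tau 0| / min_gap)%R|%N.+1.
have tN : `|t - tau 0| < N%:R * min_gap.
  rewrite -ltr_pdivrMr//; have /andP[_] := floor_itv (`|t - tau 0| / min_gap).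
  have f0 : 0 <= Num.floor (`|t - tau 0| / min_gap).
    by rewrite floor_ge0 divr_ge0// ltW.
  suff -> : (Num.floor (`|t - tau 0| / min_gap) + 1)%:~R = N%:R :> R by [].
  by rewrite -[N%:R]/(N%:Z%:~R); congr (_%:~R); rewrite /N; lia.
have lo : tau (- N%:Z) < t.
  have := min_gap_leD (- N%:Z) N; rewrite addNr.
  by move: tN; rewrite ltr_norml => /andP[? ?] ?; lra.
have hi : exists k : nat, t <= tau (- N%:Z + k%:Z).
  exists (N + N)%N; have -> : - N%:Z + (N + N)%N%:Z = 0 + N%:Z by lia.
  have := min_gap_leD 0 N.
  by move: tN; rewrite ltr_norml => /andP[? ?] ?; lra.
case: (ex_minnP hi) => -[|k] tk kmin.
  by move: tk; rewrite addr0; lra.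
exists (- N%:Z + k%:Z).
have -> : - N%:Z + k%:Z + 1 = - N%:Z + k.+1%:Z by lia.
rewrite tk andbT ltNge; apply/negP => /kmin; lia.
Qed.

Lemma index_unique t m n :
  tau m < t <= tau (m + 1) -> tau n < t <= tau (n + 1) -> m = n.
Proof.
move=> /andP[m1 m2] /andP[n1 n2].
have [mn|nm|//] := ltgtP m n.
  have : tau (m + 1) <= tau n by apply: tau_le; lia.
  by move=> ?; exfalso; lra.
have : tau (n + 1) <= tau m by apply: tau_le; lia.
by move=> ?; exfalso; lra.
Qed.

(** The index of the interval [`]tau n, tau (n + 1)]] which contains [t]; the
    default value [0] is never used, by [index_exists]. *)
Definition tau_index (t : R) : int :=
  xget 0 [set n : int | tau n < t <= tau (n + 1)].

Lemma indexP t : tau (tau_index t) < t <= tau (tau_index t + 1).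
Proof. by rewrite /tau_index; apply: (xgetPex 0 (index_exists t)). Qed.

Lemma indexE t n : tau n < t <= tau (n + 1) -> tau_index t = n.
Proof. by move=> tn; apply: (index_unique (indexP t)). Qed.

Lemma gap_bounded : exists K : R, forall n, tau (n + 1) - tau n <= K.
Proof.
have [_ _ /(_ 1 ltr01)[l l0 hl]] := tauW.
exists (tau (l + 1) - tau 0 + 1) => n.
have [p /andP[p1 p2] pP] := hl (- n).
have := pP n 1; rewrite /gap ltr_norml => /andP[? ?].
have : tau (n + p + 1) <= tau (l + 1) by apply: tau_le; lia.
have : tau 0 <= tau (n + p) by apply: tau_le; lia.
lra.
Qed.

Lemma relatively_dense_tau (P : set int) :
  relatively_dense P -> relatively_dense (tau @` P).
Proof.
move=> [l l0 hl]; have [K hK] := gap_bounded.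
have K0 : 0 < K by have := hK 0; have := min_gap_le 0; have := min_gap_gt0; lra.
have tauK n (k : nat) : tau (n + k%:Z) <= tau n + k%:R * K.
  elim: k => [|k IH]; first by rewrite mul0r !addr0.
  have := hK (n + k%:Z).
  have -> : n + k%:Z + 1 = n + k.+1%:Z by lia.
  by rewrite -[k.+1%:R]natr1; lra.
exists ((`|l|%N + 1)%:R * K).
  by rewrite mulr_gt0// ltr0n; lia.
move=> a; have /andP[i1 i2] := indexP a.
have [p /andP[p1 p2] Pp] := hl (tau_index a + 1).
exists (tau p); last by exists p.
have : tau (tau_index a + 1) <= tau p by apply: tau_le.
have : tau p <= tau (tau_index a + (`|l|%N + 1)%:Z) by apply: tau_le; lia.
have := tauK (tau_index a) (`|l|%N + 1)%N.
by move=> ? ? ?; apply/andP; split; lra.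
Qed.

(** The integers [p] such that the shift of indices by [p] moves all the points of
    the sequence by nearly the same amount as the point of index [0]. *)
Definition drift_periods (e : R) : set int :=
  [set p | forall m, `|tau (m + p) - tau m - (tau p - tau 0)| < e].

Lemma relatively_dense_drift_periods e :
  0 < e -> relatively_dense (drift_periods e).
Proof.
move=> e0; have [_ _ /(_ e e0)] := tauW.
apply: relatively_denseS => p pP m.
have := pP 0 m; rewrite /gap !add0r (addrC p m).
by congr (`|_| < _); ring.
Qed.

(** A relatively dense set of [s], each a difference of elements of [S], such that
    the translation by [s] nearly is a shift of the indices of [tau] by an almost
    period [p] of [u]. *)
Lemma relatively_dense_joint_periods (u : int -> R) (S : set R) (e : R) :
  AP_int u -> relatively_dense S -> 0 < e ->
  relatively_dense [set s | exists s1 s2 p,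
    [/\ S s1, S s2, s = s1 - s2,
        forall m, `|tau (m + p) - tau m - s| < e
      & almost_periods u e p]].
Proof.
move=> uAP Sd e0; have e'0 : 0 < e / 16%:R by rewrite divr_gt0.
have Pd := relatively_dense_common_differences R
  (relatively_dense_drift_periods e'0) (uAP _ e'0).
have Sid : relatively_dense (id @` S) by rewrite image_id.
have Td := relatively_dense_tau Pd.
apply: relatively_denseS (relatively_dense_close_differences e'0 Sid Td).
move=> _ [s1 [s2 [p [q [[S1 S2 Pp Pq] [-> /= H]]]]]].
(* For a common difference [r], the drift error is at most four times, and the
   error on [u] at most twice, the original ones. *)
have drift2 r : (exists a a' b b', [/\ drift_periods (e / 16%:R) a,
    drift_periods (e / 16%:R) a', almost_periods u (e / 16%:R) b
    & almost_periods u (e / 16%:R) b'] /\ r = a - a' /\ r = b - b') ->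
    (forall m, `|tau (m + r) - tau m - (tau r - tau 0)| < e / 4%:R) /\
    almost_periods u (e / 4%:R) r.
  move=> [a [a' [b [b' [[ha ha' hb hb'] [ra rb]]]]]]; split.
    move=> m; have := ha (m - a'); have := ha' (m - a').
    have := ha (- a'); have := ha' (- a').
    rewrite subrK addNr.
    have -> : m - a' + a = m + r by rewrite ra; lia.
    have -> : - a' + a = r by rewrite ra; lia.
    rewrite !ltr_norml => /andP[? ?] /andP[? ?] /andP[? ?] /andP[? ?].
    by apply/andP; split; lra.
  rewrite rb; apply: almost_periods_le (almost_periodsB hb hb'); lra.
have [dp up] := drift2 _ Pp; have [dq uq] := drift2 _ Pq.
exists s1, s2, (p - q); split=> //.
  move=> m; have := dp (m - q); have := dq (m - q).
  rewrite subrK; have -> : m - q + p = m + (p - q) by lia.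
  move: H.
  rewrite !ltr_norml => /andP[? ?] /andP[? ?] /andP[? ?].
  by apply/andP; split; lra.
apply: almost_periods_le (almost_periodsB up uq); lra.
Qed.

End WexlerSequence.

(** * Multiplication and division by a step function *)

Section StepQuotient.
Variables (R : realType) (tau : int -> R).
Hypothesis tauW : Wexler tau.

(** The point [t] is at distance more than [e] from every point of the sequence. *)
Definition away (e t : R) : Prop := forall j, e < `|t - tau j|.

Lemma not_away_apart e x y : 20%:R * e <= min_gap tau -> 0 < e ->
  3%:R * e <= y - x <= 6%:R * e -> ~ away e x -> ~ away e y -> False.
Proof.
move=> eg e0 /andP[xy1 xy2] /existsNP[i /negP + ] /existsNP[j /negP +].
rewrite -!leNgt !ler_norml => /andP[? ?] /andP[? ?].
have [ij|ji|ij] := ltgtP i j.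
- by have := tau_min_gap tauW ij; lra.
- by have := tau_min_gap tauW ji; lra.
- by subst; lra.
Qed.

(** One of the points [t], [t + 3 e] and [t + 6 e] is suitable: by
    [not_away_apart], at most one of them is within [e] of [tau], and at most one
    is within [e] of [tau] translated by [w]. *)
Lemma away_exists e t w : 20%:R * e <= min_gap tau -> 0 < e ->
  exists t', [/\ t <= t' <= t + 6%:R * e, away e t' & away e (t' - w)].
Proof.
move=> eg e0.
have no x y : x + 3%:R * e <= y <= x + 6%:R * e ->
    ~ away e x -> ~ away e y -> False.
  by move=> /andP[? ?]; apply: not_away_apart => //; apply/andP; split; lra.
have C z : away e z \/ ~ away e z by exact: EM.
have t1 : t <= t <= t + 6%:R * e by apply/andP; split; lra.
have t2 : t <= t + 3%:R * e <= t + 6%:R * e by apply/andP; split; lra.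
have t3 : t <= t + 6%:R * e <= t + 6%:R * e by apply/andP; split; lra.
have n12 z : ~ away e z -> ~ away e (z + 3%:R * e) -> False.
  by apply: no; apply/andP; split; lra.
have n13 z : ~ away e z -> ~ away e (z + 6%:R * e) -> False.
  by apply: no; apply/andP; split; lra.
have n23 z : ~ away e (z + 3%:R * e) -> ~ away e (z + 6%:R * e) -> False.
  by apply: no; apply/andP; split; lra.
have := n12 t; have := n13 t; have := n23 t.
have := n12 (t - w); have := n13 (t - w); have := n23 (t - w).
rewrite !(addrAC t (- w)).
have [a1|a1] := C t; have [b1|b1] := C (t - w).
- by move=> *; exists t.
all: have [a2|a2] := C (t + 3%:R * e); have [b2|b2] := C (t + 3%:R * e - w).
all: try by move=> *; exists (t + 3%:R * e).
all: have [a3|a3] := C (t + 6%:R * e); have [b3|b3] := C (t + 6%:R * e - w).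
all: try by move=> *; exists (t + 6%:R * e).
all: by move=> ? ? ? ? ? ?; exfalso; tauto.
Qed.

(** If increasing the indices by [p] moves all the points of [tau] by nearly [s],
    then the translation by [s] takes a point away from [tau], in the interval of
    index [n], to the interval of index [n + p]. *)
Lemma index_shift e s p t : away e t ->
  (forall m, `|tau (m + p) - tau m - s| < e) ->
  tau_index tau (t + s) = tau_index tau t + p.
Proof.
move=> te ps; apply: (indexE tauW).
have /andP[i1 i2] := indexP tauW t; set n := tau_index tau t in i1 i2 *.
have := ps n; have := ps (n + 1); rewrite (addrAC n 1 p).
have := te n; have := te (n + 1).
rewrite ler0_norm ?subr_le0// gtr0_norm ?subr_gt0// !ltr_norml.
by move=> ? ? /andP[? ?] /andP[? ?]; apply/andP; split; lra.
Qed.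

Variables (u : int -> R) (k K : R).
Hypotheses (k0 : 0 < k) (ukK : forall n, k <= `|u n| <= K).

(** The function equal to [u n] on [`]tau n, tau (n + 1)]]. *)
Definition step (t : R) : R := u (tau_index tau t).

Lemma step_neq0 t : step t != 0.
Proof.
rewrite -normr_gt0; have /andP[? _] := ukK (tau_index tau t).
exact: lt_le_trans k0 _.
Qed.

Lemma step_le t : `|step t| <= K.
Proof. by have /andP[] := ukK (tau_index tau t). Qed.

Lemma step_ge t : k <= `|step t|.
Proof. by have /andP[] := ukK (tau_index tau t). Qed.

Let K0 : 0 < K.
Proof. exact: lt_le_trans k0 (le_trans (step_ge 0) (step_le 0)). Qed.

Lemma step_near t : ~ range tau t -> \forall s \near t, step s = step t.
Proof.
move=> nt; have /andP[i1 i2] := indexP tauW t.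
have {}i2 : t < tau (tau_index tau t + 1).
  by rewrite lt_neqAle i2 andbT; apply/eqP => E; apply: nt; rewrite E; eexists.
near=> s; rewrite /step; congr u; apply: (indexE tauW); apply/andP; split.
  by near: s; exact: lt_nbhsr.
by apply: ltW; near: s; exact: lt_nbhsl.
Unshelve. all: by end_near. Qed.

Lemma tau_index_tau n : tau_index tau (tau n) = n - 1.
Proof.
apply: (indexE tauW); rewrite subrK lexx andbT.
have := min_gap_le tauW (n - 1); rewrite subrK.
by have := min_gap_gt0 tauW; lra.
Qed.

Lemma step_near_left n : \forall s \near (tau n)^'-, step s = u (n - 1).
Proof.
have lt : tau (n - 1) < tau n.
  by have /andP[] := indexP tauW (tau n); rewrite tau_index_tau.
near=> s; rewrite /step; congr u; apply: (indexE tauW).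
rewrite subrK; apply/andP; split; first by near: s; exact: nbhs_left_gt.
by near: s; exact: nbhs_left_le.
Unshelve. all: by end_near. Qed.

Lemma step_near_right n : \forall s \near (tau n)^'+, step s = u n.
Proof.
have lt : tau n < tau (n + 1).
  by have := min_gap_le tauW n; have := min_gap_gt0 tauW; lra.
near=> s; rewrite /step; congr u; apply: (indexE tauW).
apply/andP; split; first by near: s; exact: nbhs_right_gt.
by near: s; exact: nbhs_right_le.
Unshelve. all: by end_near. Qed.

Lemma cvg_mul_near (F : set_system R) (FF : Filter F) (h w : R -> R) (c l : R) :
  (\forall s \near F, w s = c) -> h s @[s --> F] --> l ->
  h s * w s @[s --> F] --> l * c.
Proof.
move=> wc hl.
have H : h s * c @[s --> F] --> l * c by apply: cvgM => //; exact: cvg_cst.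
apply: cvg_trans H; apply: near_eq_cvg.
by apply: filterS wc => s /= ->.
Qed.

Variables (phi f : R -> R).
Hypothesis phiE : forall t, phi t = f t * step t.

Let fE t : f t = phi t / step t.
Proof. by rewrite phiE mulfK// step_neq0. Qed.

Lemma step_mul_PC_on : continuous f ->
  PC_on tau phi /\ forall n, phi t @[t --> (tau n)^'+] --> f (tau n) * u n.
Proof.
move=> fc; have -> : phi = fun t => f t * step t by apply/funext => t.
have fr n : f t * step t @[t --> (tau n)^'+] --> f (tau n) * u n.
  by apply: cvg_mul_near; [exact: step_near_right|exact/cvg_at_right_filter/fc].
split=> //; split=> [t nt|n|n]; last by apply/cvg_ex; eexists; exact: fr.
- by apply: cvg_mul_near; [exact: step_near|exact: fc].
- rewrite {2}/step tau_index_tau.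
  by apply: cvg_mul_near; [exact: step_near_left|exact/cvg_at_left_filter/fc].
Qed.

Lemma step_div_continuous : PC_on tau phi ->
  (forall n, phi t @[t --> (tau n)^'+] --> f (tau n) * u n) -> continuous f.
Proof.
move=> [pc pl _] pr t.
have u0 n : u n != 0.
  by rewrite -normr_gt0; have /andP[? _] := ukK n; apply: lt_le_trans k0 _.
have -> : f = fun t => phi t * (step t)^-1 by apply/funext => x; exact: fE.
have [[n _ <-]|nt] := EM (range tau t); last first.
  apply: cvg_mul_near; last exact: pc.
  by apply: filterS (step_near nt) => s /= ->.
apply/left_right_continuousP; split.
  apply: cvg_mul_near; last exact: pl.
  rewrite [step (tau n)]/step tau_index_tau.
  by apply: filterS (step_near_left n) => s /= ->.
have -> : phi (tau n) / step (tau n) = f (tau n) * u n / u n.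
  by rewrite -fE mulfK.
apply: cvg_mul_near; last exact: pr.
by apply: filterS (step_near_right n) => s /= ->.
Qed.

(** Within one interval, [f] is uniformly continuous because [phi] is and [step] is
    constant; two close points belong to the same interval or to consecutive
    ones, and in the latter case [f] is continuous at the common end point. *)
Lemma pcap_quotient_uniformly_continuous :
  continuous f -> pcap tau phi -> uniformly_continuous f.
Proof.
move=> fc [_ _ phiU _] e e0.
have e30 : 0 < e / 3%:R by rewrite divr_gt0.
have [d d0 hd] := phiU (e / 3%:R * k) (mulr_gt0 e30 k0).
have same n s t : tau n < s <= tau (n + 1) -> tau n < t <= tau (n + 1) ->
    `|s - t| < d -> `|f s - f t| < e / 3%:R.
  move=> sn tn std; have := hd _ _ _ sn tn std.
  rewrite !phiE /step (indexE tauW sn) (indexE tauW tn) -mulrBl normrM => h.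
  have /andP[un _] := ukK n; rewrite -(ltr_pM2r k0); apply: le_lt_trans h.
  by rewrite ler_wpM2l.
have g0 := min_gap_gt0 tauW.
exists (Num.min d (min_gap tau)); first by rewrite lt_min d0.
move=> s t; wlog st : s t / s <= t.
  move=> H; have [/H//|/ltW/H] := leP s t.
  by rewrite distrC (distrC (f t)).
rewrite lt_min => /andP[std stg].
have /andP[s1 s2] := indexP tauW s; set n := tau_index tau s in s1 s2.
have [tn|nt] := leP t (tau (n + 1)).
  have := @same n s t; rewrite s1 s2 tn (lt_le_trans s1 st) => /(_ isT isT std).
  lra.
have g1 := min_gap_le tauW (n + 1); have g2 := min_gap_le tauW n.
rewrite ler0_norm ?subr_le0// in stg.
have t2 : t <= tau (n + 1 + 1) by lra.
have A : `|f s - f (tau (n + 1))| < e / 3%:R.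
  apply: (@same n); rewrite ?s1 ?lexx ?andbT//; first by lra.
  by move: std; rewrite !ler0_norm ?subr_le0//; lra.
have fr : f x @[x --> (tau (n + 1))^'+] --> f (tau (n + 1)).
  exact/cvg_at_right_filter/fc.
have /cvgrPdist_lt /(_ _ e30) frn := fr.
(* The interval [`]tau (n + 1), tau (n + 2)]] does not contain [tau (n + 1)], which
   is replaced by a point [r] close to it on its right. *)
near (tau (n + 1))^'+ => r.
have r1 : tau (n + 1) < r by near: r; exact: nbhs_right_gt.
have r2 : r < t by near: r; exact: nbhs_right_lt.
have B : `|f (tau (n + 1)) - f r| < e / 3%:R by near: r.
have C : `|f r - f t| < e / 3%:R.
  apply: (@same (n + 1)).
  - by rewrite r1 (le_trans (ltW r2) t2).
  - by rewrite nt t2.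
  - by move: std; rewrite !ler0_norm ?subr_le0 ?(ltW r2)//; lra.
move: A B C; rewrite !ltr_norml => /andP[? ?] /andP[? ?] /andP[? ?].
by apply/andP; split; lra.
Unshelve. all: by end_near. Qed.

(** A choice of the distance [e] to be kept from [tau], so that points move by
    less than [d] in [away_exists]. *)
Let moving_bound (d : R) : 0 < d -> exists2 e : R, 0 < e &
  [/\ 20%:R * e <= min_gap tau, 6%:R * e < d & e <= d].
Proof.
move=> d0; have g0 := min_gap_gt0 tauW.
have m0 : 0 < Num.min (min_gap tau) d by rewrite lt_min g0.
have : Num.min (min_gap tau) d <= min_gap tau by rewrite ge_min lexx.
have : Num.min (min_gap tau) d <= d by rewrite ge_min lexx orbT.
by exists (Num.min (min_gap tau) d / 20%:R); [lra|split; lra].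
Qed.

(** An almost period of [phi] brings any point away from [tau] into a fixed
    segment, where [f] is bounded by continuity. *)
Lemma pcap_quotient_bounded : continuous f -> pcap tau phi ->
  exists B : R, forall t, `|f t| <= B.
Proof.
move=> fc phiP; have fU := pcap_quotient_uniformly_continuous fc phiP.
have [d d0 hd] := fU 1 ltr01.
have [e e0 [eg ed _]] := moving_bound d0.
have [_ _ _ phiAP] := phiP.
have [l l0 hl] := phiAP e e0.
have [M hM] := continuous_itv_bounded (ltW l0) fc.
have M0 : 0 <= M by apply: le_trans (hM 0 _) => //; rewrite lexx ltW.
exists ((M * K + e) / k + 1) => t.
have [t' [/andP[t1 t2] ta _]] := away_exists t 0 eg e0.
have [s /andP[s1 s2] hs] := hl (- t').
have {}hs : `|phi (t' + s) - phi t'| < e := hs _ ta.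
have Ms : `|phi (t' + s)| <= M * K.
  rewrite phiE normrM; apply: ler_pM => //; last exact: step_le.
  by apply: hM; apply/andP; split; lra.
have Mt' : `|phi t'| <= M * K + e.
  rewrite (_ : phi t' = phi (t' + s) - (phi (t' + s) - phi t')); last by ring.
  by apply: le_trans (ler_normB _ _) _; rewrite lerD// ltW.
have ft' : `|f t'| <= (M * K + e) / k.
  rewrite fE normrM normfV; apply: ler_pM => //.
  by rewrite lef_pV2 ?posrE ?step_ge// normr_gt0 step_neq0.
have : `|f t - f t'| < 1 by apply: hd; rewrite ler0_norm; lra.
move: ft'; rewrite ltr_norml !ler_norml => /andP[? ?] /andP[? ?].
by apply/andP; split; lra.
Qed.

Hypothesis uAP : AP_int u.

Lemma pcap_quotient_AP : continuous f -> pcap tau phi -> AP_real f.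
Proof.
move=> fc phiP; split=> // e e0.
have fU := pcap_quotient_uniformly_continuous fc phiP.
have [B hB] := pcap_quotient_bounded fc phiP.
have B0 : 0 <= B by apply: le_trans (hB 0).
have [_ _ _ phiAP] := phiP.
have e40 : 0 < e / 4%:R by rewrite divr_gt0.
have [d d0 hd] := fU _ e40.
have bnd : 0 < Num.min d (e / 4%:R * k / (2%:R + B)).
  by rewrite lt_min d0 divr_gt0 ?mulr_gt0//; lra.
have [r r0 [rg]] := moving_bound bnd.
rewrite lt_min le_min => /andP[rd _] /andP[_].
rewrite ler_pdivlMr; last by lra.
move=> re.
have Jd := relatively_dense_joint_periods tauW uAP (phiAP r r0) r0.
apply: relatively_denseS Jd.
move=> s [s1 [s2 [p [S1 S2 sE ps up]]]] t.
have [t' [/andP[t1 t2] ta tb]] := away_exists t s2 rg r0.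
have idx := index_shift ta ps.
(* Both [s1] and [s2] are used as almost periods at the point [t' - s2]. *)
have P1 : `|phi (t' - s2 + s1) - phi (t' - s2)| < r := S1 _ tb.
have P2 : `|phi t' - phi (t' - s2)| < r by have := S2 _ tb; rewrite subrK.
have st : t' - s2 + s1 = t' + s by rewrite sE; ring.
rewrite st in P1.
have P : `|phi (t' + s) - phi t'| < 2%:R * r.
  move: P1 P2; rewrite !ltr_norml => /andP[? ?] /andP[? ?].
  by apply/andP; split; lra.
have U := up (tau_index tau t').
have F : `|f (t' + s) - f t'| < e / 4%:R.
  rewrite -(ltr_pM2r k0).
  have -> : f (t' + s) - f t' =
     ((phi (t' + s) - phi t') - f t' * (step (t' + s) - step t'))
     / step (t' + s).
    by rewrite !phiE; field; exact: step_neq0.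
  rewrite normrM normfV -mulrA.
  apply: (@le_lt_trans _ _
      (`|phi (t' + s) - phi t' - f t' * (step (t' + s) - step t')|)).
    rewrite ler_piMr// mulrC ler_pdivrMr ?normr_gt0 ?step_neq0// mul1r.
    exact: step_ge.
  apply: le_lt_trans (ler_normB _ _) _.
  have : `|f t' * (step (t' + s) - step t')| <= B * r.
    by rewrite normrM ler_pM//; rewrite /step idx; exact: ltW.
  lra.
have N1 : `|t - t'| < d by rewrite ler0_norm; lra.
have N2 : `|t + s - (t' + s)| < d by rewrite opprD addrACA subrr addr0.
have := hd _ _ N1; have := hd _ _ N2; move: F.
rewrite !ltr_norml => /andP[? ?] /andP[? ?] /andP[? ?].
by apply/andP; split; lra.
Qed.

Lemma AP_real_mul_step_pcap : AP_real f -> pcap tau phi.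
Proof.
move=> fAP; have [fc fd] := fAP.
have fU := AP_real_uniformly_continuous fAP.
have [B hB] := AP_real_bounded fAP.
have B0 : 0 <= B by apply: le_trans (hB 0).
have [tA _ tE] := tauW.
have [phiPC _] := step_mul_PC_on fc.
split=> // e e0.
  have [d d0 hd] := fU _ (divr_gt0 e0 K0); exists d => // n s t sn tn std.
  rewrite !phiE /step (indexE tauW sn) (indexE tauW tn) -mulrBl normrM.
  have := hd _ _ std; rewrite ltr_pdivlMr//; apply: le_lt_trans.
  by rewrite ler_wpM2l//; have /andP[] := ukK n.
have KB : 0 < 2%:R * K + B by have := K0; lra.
pose r := Num.min e (e / (2%:R * K + B)).
have r0 : 0 < r by rewrite lt_min e0 divr_gt0.
have re : r <= e by rewrite ge_min lexx.
have rb : r * (2%:R * K + B) <= e.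
  by rewrite -ler_pdivlMr// ge_min lexx orbT.
apply: relatively_denseS (relatively_dense_joint_periods tauW uAP (fd r r0) r0).
move=> s [s1 [s2 [p [S1 S2 sE ps up]]]] t ta.
have idx : tau_index tau (t + s) = tau_index tau t + p.
  by apply: (@index_shift r) => // j; exact: le_lt_trans re (ta j).
have F := almost_periodsB S1 S2 t; rewrite -sE in F.
have U := up (tau_index tau t).
have -> : phi (t + s) - phi t =
    (f (t + s) - f t) * step (t + s) + f t * (step (t + s) - step t).
  by rewrite !phiE; ring.
apply: le_lt_trans (ler_normD _ _) _.
have : `|f t * (step (t + s) - step t)| <= B * r.
  by rewrite normrM ler_pM//; rewrite /step idx; exact: ltW.
have : `|(f (t + s) - f t) * step (t + s)| < (r + r) * K.
  rewrite normrM; apply: (@le_lt_trans _ _ (`|f (t + s) - f t| * K)).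
    by rewrite ler_wpM2l// step_le.
  by rewrite ltr_pM2r.
lra.
Qed.
End StepQuotient.

(** * The impulsive system and the system with continuous solutions *)

Lemma is_derive_mul_near (R : realType) (h w : R -> R) (t c l : R) :
  (\forall s \near t, w s = c) -> is_derive t 1 h l ->
  is_derive t 1 (fun s => h s * w s) (l * c).
Proof.
move=> wc hl; apply: (@near_eq_is_derive _ _ _ (c *: (h : R -> R^o))).
  by apply: filterS wc => s /= ->; rewrite mulrC.
by rewrite mulrC; exact: is_deriveZ.
Qed.

Lemma mult_prod_recurrence (R : realType) (b v : int -> R) :
  (forall n, 1 + b n != 0) -> (forall n, v n = (1 + b n) * v (n - 1)) ->
  forall n, v n = mult_prod b n * v 0.
Proof.
move=> b0 vrec [m|m] /=.
  elim: m => [|m IH]; first by rewrite big_geq// mul1r.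
  rewrite big_nat_recr//= vrec.
  have -> : m.+1%:Z - 1 = m by lia.
  by rewrite IH mulrA (mulrC (1 + _)).
have vback n : v (n - 1) = (1 + b n)^-1 * v n by rewrite (vrec n) mulKf.
elim: m => [|m IH].
  rewrite big_nat1.
  have -> : Negz 0 = 0 - 1 by lia.
  by rewrite vback.
rewrite big_nat_recr//= (_ : Negz m.+1 = Negz m - 1); last by lia.
by rewrite vback IH mulrA (mulrC (_^-1)) NegzE.
Qed.

Lemma mult_prod_bounds_AP (R : realType) (b : int -> R) :
  AP_int b -> 0 < inf (range (fun n : int => `|1 + b n|)) ->
  (exists v : int -> R,
     [/\ forall n : int, v n = (1 + b n) * v (n - 1),
         bounded_fun v
       & 0 < inf (range (fun n : int => `|v n|))]) ->
  [/\ forall n, mult_prod b n = (1 + b n) * mult_prod b (n - 1),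
      exists k K : R, 0 < k /\ forall n, k <= `|mult_prod b n| <= K
    & AP_int (mult_prod b)].
Proof.
move=> bAP c0 [v [vrec vbd kv0]].
have bc := inf_gt0_lower_bound 0 c0.
have vk := inf_gt0_lower_bound 0 kv0.
set c := inf _ in c0 bc; set kv := inf _ in kv0 vk.
have b0 n : 1 + b n != 0 by rewrite -normr_gt0; exact: lt_le_trans c0 (bc n).
have v0 : 0 < `|v 0| by exact: lt_le_trans kv0 (vk 0).
have vE := mult_prod_recurrence b0 vrec.
have v00 : v 0 != 0 by rewrite -normr_gt0.
have uE n : mult_prod b n = v n / v 0 by rewrite vE mulfK.
have urec n : mult_prod b n = (1 + b n) * mult_prod b (n - 1).
  by rewrite !uE mulrA -vrec.
have [M vM] : exists M : R, forall n, `|v n| <= M.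
  have [M [_ hM]] := vbd; exists (M + 1) => n.
  by apply: (hM (M + 1)); rewrite ?ltrDl.
have ub n : kv / `|v 0| <= `|mult_prod b n| <= M / `|v 0|.
  by rewrite uE normrM normfV !ler_pM2r ?invr_gt0// vk vM.
have k0 : 0 < kv / `|v 0| by rewrite divr_gt0.
split=> //; first by exists (kv / `|v 0|), (M / `|v 0|).
exact: AP_int_linear_recurrence bAP c0 bc k0 ub urec.
Qed.

Theorem theorem1p3 (R : realType) (d : nat) (d_gt0 : (0 < d)%N)
  (g : 'I_d -> 'rV[R]_d * R -> R) (g_cont : forall i, continuous (g i))
  (tau : int -> R) (tau_W : Wexler tau)
  (b : 'I_d -> int -> R)
  (b_AP : forall i, AP_int (b i))
  (b_inf : forall i, 0 < inf (range (fun n : int => `|1 + b i n|)))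
  (b_sol : forall i, exists v : int -> R,
     [/\ forall n : int, v n = (1 + b i n) * v (n - 1),
         bounded_fun v
       & 0 < inf (range (fun n : int => `|v n|))]) :
  (forall phi : 'I_d -> R -> R,
     solution_I g tau b phi -> (forall i, pcap tau (phi i)) ->
     (forall i (n : int), phi i (tau n) != 0) ->
     solution_D g tau b (fun i t => phi i t / step_fun tau (b i) t) /\
     (forall i, AP_real (fun t => phi i t / step_fun tau (b i) t))) /\
  (forall phi : 'I_d -> R -> R,
     solution_D g tau b (fun i t => phi i t / step_fun tau (b i) t) ->
     (forall i, AP_real (fun t => phi i t / step_fun tau (b i) t)) ->
     solution_I g tau b phi /\ (forall i, pcap tau (phi i))).
Proof.
have U i := mult_prod_bounds_AP (b_AP i) (b_inf i) (b_sol i).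
have nz i t : step_fun tau (b i) t != 0.
  by have [_ [k [K [k0 kK]]] _] := U i; exact: (step_neq0 tau k0 kK).
split=> phi.
  move=> [phiPC phiD phiJ] phiP _.
  pose f i t := phi i t / step_fun tau (b i) t.
  have phiE i t : phi i t = f i t * step tau (mult_prod (b i)) t.
    by rewrite /f divfK// nz.
  have fc i : continuous (f i).
    have [urec [k [K [k0 kK]]] uAP] := U i.
    apply: (step_div_continuous tau_W k0 kK (phiE i) (phiPC i)) => n.
    have -> : f i (tau n) * mult_prod (b i) n = (1 + b i n) * phi i (tau n).
      by rewrite phiE /step tau_index_tau// urec; ring.
    exact: phiJ.
  split; last first.
    move=> i; have [urec [k [K [k0 kK]]] uAP] := U i.
    exact: (pcap_quotient_AP tau_W k0 kK (phiE i) uAP (fc i) (phiP i)).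
  split=> // i t nt.
  have -> : \row_j (step_fun tau (b j) t * (phi j t / step_fun tau (b j) t)) =
      \row_j phi j t.
    by apply/rowP => j; rewrite !mxE mulrC divfK.
  apply: is_derive_mul_near; last exact: phiD.
  apply: filterS (step_near tau_W (mult_prod (b i)) nt) => s /= E.
  by congr _^-1.
move=> [fc fD] fAP.
pose f i t := phi i t / step_fun tau (b i) t.
have phiE i t : phi i t = f i t * step tau (mult_prod (b i)) t.
  by rewrite /f divfK// nz.
have PC i : PC_on tau (phi i) /\ forall n,
    phi i t @[t --> (tau n)^'+] --> f i (tau n) * mult_prod (b i) n.
  have [urec [k [K [k0 kK]]] uAP] := U i.
  exact: (step_mul_PC_on tau_W (phiE i) (fc i)).
split.
  split=> [i|i t nt|i n]; first by have [] := PC i.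
  - have -> : phi i = fun t => f i t * step tau (mult_prod (b i)) t.
      by apply/funext => s.
    have := fD i t nt.
    have -> : \row_j (step_fun tau (b j) t * (phi j t / step_fun tau (b j) t)) =
        \row_j phi j t.
      by apply/rowP => j; rewrite !mxE mulrC divfK.
    move=> /(is_derive_mul_near (step_near tau_W (mult_prod (b i)) nt)).
    by rewrite -[step _ _ _]/(step_fun tau (b i) t) divfK.
  - have [_ /(_ n)] := PC i; have [urec _ _] := U i.
    rewrite phiE [step _ _ _]/step tau_index_tau// urec.
    by rewrite mulrCA.
move=> i; have [urec [k [K [k0 kK]]] uAP] := U i.
exact: (AP_real_mul_step_pcap tau_W k0 kK (phiE i) uAP (fAP i)).
Qed.
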